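(* Let $t,a_1,a_2\in\mathbb C$ with $a_1\neq0$. Consider the rational map $$\varphi:\ \mathcal X^{\mathrm{Tak}}\setminus D^{\mathrm{Tak}}\longrightarrow \mathcal X^{\mathrm{Ok}}\setminus D^{\mathrm{Ok}}$$ defined by $$f=\Big(\frac q2\Big)^2,\qquad g=\frac t2+\frac{2a_1}{q^2}+\frac{p}{2q}+\frac{q^2}{16}.$$ Then $\varphi$ is a morphism (it has no indeterminacies) and has empty critical locus (it does not blow down any curve, and all its fibres are finite). Further, its ramification (branch) locus in $\mathcal X^{\mathrm{Ok}}\setminus D^{\mathrm{Ok}}$ consists of the parts away from $D^{\mathrm{Ok}}$ of the exceptional divisors $E_2,E_4,E_8$ and of the proper transform of $\{f=0\}$.
   Context: Blow-up convention: after blowing up a point given in an affine chart by $(x,y)=(x^*,y^* )$, the $i$-th exceptional curve is covered by charts $(u_i,v_i)$ and $(U_i,V_i)$ with $x-x^*=u_iv_i,\ y-y^*=v_i$ and $x-x^*=V_i,\ y-y^*=U_iV_i$. The notation $q_i\leftarrow q_j$ means that $q_j$ lies on the exceptional curve of $q_i$. The charts for the two surfaces below are unrelated although the same letters are used. Surface $\mathcal X^{\mathrm{Tak}}$: compactify $\mathbb C^2_{q,p}$ to $\mathbb P^1\times\mathbb P^1$ with $Q=1/q$, $P=1/p$, and blow up the 20 points $q_1:(q,P)=(0,0)$; over it $q_2:(u_1,v_1)=(4a_1,0)\leftarrow q_3:(u_2,v_2)=(0,0)$ and $q_4:(u_1,v_1)=(-4a_1,0)\leftarrow q_5:(u_4,v_4)=(0,0)$;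 $q_6:(Q,P)=(0,0)\leftarrow q_7:(U_6,V_6)=(0,0)\leftarrow q_8:(u_7,v_7)=(0,0)$; over $q_8$ the two chains $q_9:(u_8,v_8)=(8,0)\leftarrow q_{10}:(u_9,v_9)=(0,0)\leftarrow q_{11}:(u_{10},v_{10})=(-64t,0)\leftarrow q_{12}:(u_{11},v_{11})=(0,0)\leftarrow q_{13}:(u_{12},v_{12})=(256(2+2t^2-a_1-2a_2),0)\leftarrow q_{14}:(u_{13},v_{13})=(0,0)$ and $q_{15}:(u_8,v_8)=(-8,0)\leftarrow q_{16}:(u_{15},v_{15})=(0,0)\leftarrow q_{17}:(u_{16},v_{16})=(64t,0)\leftarrow q_{18}:(u_{17},v_{17})=(0,0)\leftarrow q_{19}:(u_{18},v_{18})=(-256(2t^2-a_1-2a_2),0)\leftarrow q_{20}:(u_{19},v_{19})=(0,0)$. $D^{\mathrm{Tak}}$ is the union of the proper transforms of $\{q=0\}$, $\{q=\infty\}$, $\{p=\infty\}$ and of the proper transforms of the exceptional curves of all $q_i$ with $i\notin\{3,5,14,20\}$. Surface $\mathcal X^{\mathrm{Ok}}$: compactify $\mathbb C^2_{f,g}$ to $\mathbb P^1\times\mathbb P^1$ with $F=1/f$, $G=1/g$, and blow up the 8 points $p_1:(F,g)=(0,0)\leftarrow p_2:(U_1,V_1)=(-a_2,0)$; $p_3:(f,G)=(0,0)\leftarrow p_4:(u_3,v_3)=(a_1,0)$; $p_5:(F,G)=(0,0)\leftarrow p_6:(U_5,V_5)=(2,0)\leftarrow p_7:(u_6,v_6)=(-4t,0)\leftarrow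 p_8:(u_7,v_7)=(4(1-a_1-a_2+2t^2),0)$. $E_i$ denotes the exceptional divisor of $p_i$. $D^{\mathrm{Ok}}$ is the union of the proper transforms of $\{f=\infty\}$, $\{g=\infty\}$ and of the exceptional curves of $p_1,p_3,p_5,p_6,p_7$. *)

(* Defs.v *)
From Stdlib Require List.
From mathcomp Require Import all_boot all_order all_algebra.
From mathcomp Require Import mathcomp_extra boolp classical_sets functions.
From mathcomp Require Import cardinality reals.
From mathcomp Require Import complex.

Set Implicit Arguments.
Unset Strict Implicit.
Unset Printing Implicit Defensive.

Import GRing.Theory.
Local Open Scope classical_set_scope.
Local Open Scope ring_scope.

(* A surface obtained from P^1 x P^1 by successive point blow-ups is          *)
(* represented by the list of its centers.  Its closed points are those of    *)
(* P^1 x P^1 and of the exceptional curves, minus the centers; its algebraic  *)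
(* structure is carried by affine charts, i.e. partial parametrizations of    *)
(* the surface by K^2.                                                        *)
Section Surfaces.
Variable K : fieldType.

(* AffChart ix iy: the chart of P^1 x P^1 whose first coordinate is x, or 1/x *)
(* if ix, and whose second coordinate is y, or 1/y if iy.                     *)
(* BlChart b c x0 y0: after blowing up the point with coordinates (x0, y0) in *)
(* the chart c, the chart (u, v) if b = false, and (U, V) if b = true.        *)
Inductive chart : Type :=
| AffChart of bool & bool
| BlChart of bool & chart & K & K.

Record center : Type := Center { cchart : chart; cx : K; cy : K }.

Definition chart_u (q : center) : chart := BlChart false (cchart q) (cx q) (cy q).
Definition chart_U (q : center) : chart := BlChart true (cchart q) (cx q) (cy q).

(* Some a is the point a of the affine line, None is the point at infinity. *)
Definition P1 : Type := option K.

(* Exc q (Some u) is the point (u_q, v_q) = (u, 0) of the exceptional curve   *)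
(* of q, and Exc q None is its point (U_q, V_q) = (0, 0).                     *)
Inductive spoint : Type :=
| Base of P1 & P1
| Exc of center & P1.

Definition inP1 (inv : bool) (a : K) : P1 :=
  if inv then (if a == 0 then None else Some a^-1) else Some a.

Fixpoint chart_pt (c : chart) (a b : K) : spoint :=
  match c with
  | AffChart ix iy => Base (inP1 ix a) (inP1 iy b)
  | BlChart false c0 x0 y0 =>
      if b == 0 then Exc (Center c0 x0 y0) (Some a)
      else chart_pt c0 (x0 + a * b) (y0 + b)
  | BlChart true c0 x0 y0 =>
      if b == 0 then Exc (Center c0 x0 y0) (inP1 true a)
      else chart_pt c0 (x0 + b) (y0 + a * b)
  end.

Lemma chart_uU (q : center) (u v : K) : u != 0 ->
  chart_pt (chart_u q) u v = chart_pt (chart_U q) u^-1 (u * v).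
Proof.
move=> u0 /=; rewrite mulf_eq0 (negbTE u0) /= invr_eq0 (negbTE u0) invrK.
by case: ifP => // _; rewrite mulKf.
Qed.

Definition center_pt (q : center) : spoint := chart_pt (cchart q) (cx q) (cy q).

Definition blowup (s : seq center) : set spoint :=
  [set x | match x with Base _ _ => True | Exc q _ => List.In q s end /\
           forall q, List.In q s -> x <> center_pt q].

Definition is_chart (s : seq center) (c : chart) : Prop :=
  match c with
  | AffChart _ _ => True
  | BlChart _ c0 x0 y0 => List.In (Center c0 x0 y0) s
  end.

(* A distinguished chart around a point, and the coordinates of the point. *)
Definition chart_at (x : spoint) : chart :=
  match x with
  | Base x y => AffChart (~~ isSome x) (~~ isSome y)
  | Exc q (Some _) => chart_u q
  | Exc q None => chart_U q
  end.

Definition coord_at (x : spoint) : K * K :=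
  match x with
  | Base x y => (odflt 0 x, odflt 0 y)
  | Exc q (Some u) => (u, 0)
  | Exc q None => (0, 0)
  end.

Lemma chart_atK (x : spoint) :
  chart_pt (chart_at x) (coord_at x).1 (coord_at x).2 = x.
Proof.
by case: x => [[a|] [b|]|[c x0 y0] [u|]] //=; rewrite /inP1 ?eqxx.
Qed.

(* Value at (a, b) of a polynomial in two variables, 'X being the first one   *)
(* and 'Y the variable of the coefficients.                                   *)
Definition ev (h : {poly {poly K}}) (a b : K) : K := h.[a%:P].[b].

(* The sets D(h) of the charts form a basis of the Zariski topology. *)
Definition basic_open (s : seq center) (c : chart) (h : {poly {poly K}}) :
    set spoint :=
  [set x | blowup s x /\ exists a b, ev h a b != 0 /\ x = chart_pt c a b].

Definition zclosure (s : seq center) (A : set spoint) : set spoint :=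
  [set x | blowup s x /\
     forall c h, is_chart s c -> basic_open s c h x ->
       exists2 y, basic_open s c h y & A y].

Definition proper_transform (s : seq center) (A : set spoint) : set spoint :=
  zclosure s (A `&` blowup s).

Definition exc_curve (q : center) : set spoint :=
  [set x | exists s : P1, x = Exc q s].
Definition line_x (a : P1) : set spoint := [set x | exists b : P1, x = Base a b].
Definition line_y (b : P1) : set spoint := [set x | exists a : P1, x = Base a b].

(* Below, W is an open subset of blowup s. *)

Definition closed_in (s : seq center) (W A : set spoint) : Prop :=
  A `<=` W /\ zclosure s A `&` W `<=` A.

Definition irreducible_closed (s : seq center) (W A : set spoint) : Prop :=
  [/\ closed_in s W A, A !=set0 &
      forall B1 B2, closed_in s W B1 -> closed_in s W B2 ->
        A `<=` B1 `|` B2 -> A `<=` B1 \/ A `<=` B2].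

(* Irreducible closed subsets of Krull dimension 1. *)
Definition curve_in (s : seq center) (W A : set spoint) : Prop :=
  [/\ irreducible_closed s W A,
      exists2 B, irreducible_closed s W B & B `<` A &
      ~ exists B1 B2, [/\ irreducible_closed s W B1, irreducible_closed s W B2,
                          B1 `<` B2 & B2 `<` A]].

(* Near the point with coordinates z in the chart c, and in the charts c, c', *)
(* phi is the map (N1 / h, N2 / h).                                           *)
Definition local_expr (W : set spoint) (phi : spoint -> spoint)
    (c : chart) (z : K * K) (c' : chart) (N1 N2 h : {poly {poly K}}) : Prop :=
  ev h z.1 z.2 != 0 /\
  forall a b, W (chart_pt c a b) -> ev h a b != 0 ->
    phi (chart_pt c a b) =
    chart_pt c' (ev N1 a b / ev h a b) (ev N2 a b / ev h a b).

Definition is_morphism (s : seq center) (W : set spoint)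
    (s' : seq center) (W' : set spoint) (phi : spoint -> spoint) : Prop :=
  set_fun W W' phi /\
  forall x, W x -> exists c z c' N1 N2 h,
    [/\ is_chart s c, chart_pt c z.1 z.2 = x, is_chart s' c' &
        local_expr W phi c z c' N1 N2 h].

(* Union of the curves that phi blows down. *)
Definition critical_locus (s : seq center) (W : set spoint)
    (phi : spoint -> spoint) : set spoint :=
  \bigcup_(A in [set A | curve_in s W A /\ exists y, phi @` A = [set y]]) A.

(* d is one of the two partial derivatives below. *)
Definition dquot (d : {poly {poly K}} -> {poly {poly K}})
    (N h : {poly {poly K}}) (z : K * K) : K :=
  (ev (d N) z.1 z.2 * ev h z.1 z.2 - ev N z.1 z.2 * ev (d h) z.1 z.2)
  / ev h z.1 z.2 ^+ 2.

Definition dX (p : {poly {poly K}}) : {poly {poly K}} := p^`().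
Definition dY (p : {poly {poly K}}) : {poly {poly K}} :=
  map_poly (fun r : {poly K} => r^`()) p.

Definition jacobian (N1 N2 h : {poly {poly K}}) (z : K * K) : K :=
  dquot dX N1 h z * dquot dY N2 h z - dquot dY N1 h z * dquot dX N2 h z.

(* The differential of phi at x, read in charts around x and phi x, is        *)
(* singular; neither the charts nor the local expression matter.              *)
Definition ramified_at (W : set spoint) (phi : spoint -> spoint) (x : spoint) :
    Prop :=
  exists N1 N2 h,
    local_expr W phi (chart_at x) (coord_at x) (chart_at (phi x)) N1 N2 h /\
    jacobian N1 N2 h (coord_at x) = 0.

Definition branch_locus (W : set spoint) (phi : spoint -> spoint) : set spoint :=
  phi @` [set x | W x /\ ramified_at W phi x].

End Surfaces.

(* (x, y) = (q, p) on P^1 x P^1. *)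
Section Takasaki.
Variables (K : fieldType) (t a1 a2 : K).

Definition tak1 : center K := Center (AffChart K false true) 0 0.
Definition tak2 := Center (chart_u tak1) (4 * a1) 0.
Definition tak3 := Center (chart_u tak2) 0 0.
Definition tak4 := Center (chart_u tak1) (- (4 * a1)) 0.
Definition tak5 := Center (chart_u tak4) 0 0.
Definition tak6 : center K := Center (AffChart K true true) 0 0.
Definition tak7 := Center (chart_U tak6) 0 0.
Definition tak8 := Center (chart_u tak7) 0 0.
Definition tak9 := Center (chart_u tak8) 8 0.
Definition tak10 := Center (chart_u tak9) 0 0.
Definition tak11 := Center (chart_u tak10) (- (64 * t)) 0.
Definition tak12 := Center (chart_u tak11) 0 0.
Definition tak13 :=
  Center (chart_u tak12) (256 * (2 + 2 * t ^+ 2 - a1 - 2 * a2)) 0.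
Definition tak14 := Center (chart_u tak13) 0 0.
Definition tak15 := Center (chart_u tak8) (- 8) 0.
Definition tak16 := Center (chart_u tak15) 0 0.
Definition tak17 := Center (chart_u tak16) (64 * t) 0.
Definition tak18 := Center (chart_u tak17) 0 0.
Definition tak19 :=
  Center (chart_u tak18) (- (256 * (2 * t ^+ 2 - a1 - 2 * a2))) 0.
Definition tak20 := Center (chart_u tak19) 0 0.

Definition tak_centers : seq (center K) :=
  [:: tak1; tak2; tak3; tak4; tak5; tak6; tak7; tak8; tak9; tak10;
      tak11; tak12; tak13; tak14; tak15; tak16; tak17; tak18; tak19; tak20].

Definition tak_X : set (spoint K) := blowup tak_centers.

Definition tak_D : set (spoint K) :=
  proper_transform tak_centers (line_x (Some 0)) `|`
  proper_transform tak_centers (line_x None) `|`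
  proper_transform tak_centers (line_y None) `|`
  [set x | exists2 q,
     List.In q [:: tak1; tak2; tak4; tak6; tak7; tak8; tak9; tak10; tak11;
                   tak12; tak13; tak15; tak16; tak17; tak18; tak19] &
     proper_transform tak_centers (exc_curve q) x].

End Takasaki.

(* (x, y) = (f, g) on P^1 x P^1. *)
Section Okamoto.
Variables (K : fieldType) (t a1 a2 : K).

Definition ok1 : center K := Center (AffChart K true false) 0 0.
Definition ok2 := Center (chart_U ok1) (- a2) 0.
Definition ok3 : center K := Center (AffChart K false true) 0 0.
Definition ok4 := Center (chart_u ok3) a1 0.
Definition ok5 : center K := Center (AffChart K true true) 0 0.
Definition ok6 := Center (chart_U ok5) 2 0.
Definition ok7 := Center (chart_u ok6) (- (4 * t)) 0.
Definition ok8 := Center (chart_u ok7) (4 * (1 - a1 - a2 + 2 * t ^+ 2)) 0.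

Definition ok_centers : seq (center K) :=
  [:: ok1; ok2; ok3; ok4; ok5; ok6; ok7; ok8].

Definition ok_X : set (spoint K) := blowup ok_centers.

Definition ok_D : set (spoint K) :=
  proper_transform ok_centers (line_x None) `|`
  proper_transform ok_centers (line_y None) `|`
  [set x | exists2 q, List.In q [:: ok1; ok3; ok5; ok6; ok7] &
     proper_transform ok_centers (exc_curve q) x].

End Okamoto.

(* The maps (q, p) |-> f, g. *)
Definition phi_f (K : fieldType) (q : K) : K := (q / 2) ^+ 2.
Definition phi_g (K : fieldType) (t a1 q p : K) : K :=
  t / 2 + 2 * a1 / q ^+ 2 + p / (2 * q) + q ^+ 2 / 16.

(* Main.v *)
Require Import Defs.
From mathcomp Require Import all_boot all_order all_algebra.
From mathcomp Require Import mathcomp_extra boolp classical_sets functions.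
From mathcomp Require Import cardinality reals.
From mathcomp Require Import complex ring.

(* Removing D leaves only the points of the affine chart (with q <> 0 on the  *)
(* Takasaki side) and the affine parts of the last exceptional curves.  Near  *)
(* the curves of q_3, q_5, q_14, q_20, with coordinates (u, v) and equation   *)
(* v = 0, phi is invariant under v |-> - v, as it is under (q, p) |-> (-q,-p),*)
(* hence it ramifies there; restricted to v = 0 it is an affine bijection     *)
(* onto E_4, {f = 0}, E_8, E_2 away from D.  On the affine chart the Jacobian *)
(* is 1 / 4.  Finite fibres rule out contracted curves, because a finite      *)
(* irreducible closed set is a point.                                         *)

(** The involution (q, p) |-> (-q, -p) preserves f and g, and near each of the four last exceptional
    curves it fixes u and sends v to -v. The positions of the centers of both surfaces are exactly
    such that the polar parts cancel when f and g are rewritten in these coordinates: one target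
    coordinate becomes v ^ 2 times a function regular near the curve, the other a fraction regular
    along v = 0. These are the lemmas [local_expr_tak3], [local_expr_tak5], [local_expr_tak14] and
    [local_expr_tak20]; with [local_expr_base] they give the morphism.

    The factor v ^ 2 kills the Jacobian on v = 0 ([dquot_vsq]), and the lemmas [phi_affine*] show
    that each curve is sent bijectively onto its image, so the branch locus contains the four
    curves. Conversely [base_unramified] finds the Jacobian 1 / 4 for every local expression at an
    affine point. A fibre has finitely many points because f determines q up to sign, g is then
    affine in p, and the restriction to each exceptional curve is injective;
    [critical_locus_finite_fibres] concludes.

    The complements of D are identified in [ok_goodE] and [tak_goodE], where Zariski closures are
    tested on basic open sets of the charts. *)

Set Implicit Arguments.
Unset Strict Implicit.
Unset Printing Implicit Defensive.

Import Order.TTheory GRing.Theory Num.Theory.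
Local Open Scope classical_set_scope.
Local Open Scope ring_scope.

(** * Charts as towers of blow-ups, and proper transforms *)

Section Charts.
Variable K : fieldType.
Implicit Types (c : chart K) (q : center K).

(** Forgetting the coordinates of the centers, which depend on the parameters, makes shapes
    comparable by computation. *)
Fixpoint chart_shape c : seq bool :=
  match c with
  | AffChart ix iy => [:: ix; iy]
  | BlChart b c0 _ _ => b :: chart_shape c0
  end.

Fixpoint blown_in c q : Prop :=
  match c with
  | AffChart _ _ => False
  | BlChart _ c0 x0 y0 => q = Center c0 x0 y0 \/ blown_in c0 q
  end.

Lemma chart_pt_Exc c a b q s : chart_pt c a b = Exc q s -> blown_in c q.
Proof.
elim: c a b => [//|[] c0 IH x0 y0 a b] /=; case: eqP => _;
  by [move=> [<- _]; left | move/IH; right].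
Qed.

Lemma blown_in_suffix c q :
  blown_in c q -> suffix (chart_shape (cchart q)) (behead (chart_shape c)).
Proof.
elim: c => [//|b c0 IH x0 y0] /= [->|/IH] /=; first exact: suffix_refl.
by case: (chart_shape c0) => [//|d l] /= qc; apply: suffix_trans qc (suffix_cons _ _).
Qed.

(** Going down a tower strictly shortens the shape. Hence a chart never meets the exceptional curve
    of a center placed in it. *)
Lemma blown_in_irr q : ~ blown_in (cchart q) q.
Proof.
move=> /blown_in_suffix /size_suffix; rewrite size_behead.
by case: (cchart q) => [ix iy|d c0 x0 y0] /=; rewrite ltnn.
Qed.

Lemma inP1_inj i : injective (@inP1 K i).
Proof.
move=> a b; rewrite /inP1; case: i => [|[]//].
by do 2 case: eqP => //; [move=> -> -> | move=> _ _ [/invr_inj]].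
Qed.

(** Off the new exceptional curve the blow-down is invertible, and by [blown_in_irr] the points on
    that curve differ from those coming from the chart below. *)
Lemma chart_pt_inj c a b a' b' :
  chart_pt c a b = chart_pt c a' b' -> a = a' /\ b = b'.
Proof.
elim: c a b a' b' => [ix iy|d c0 IH x0 y0] a b a' b' /=.
  by case=> /inP1_inj -> /inP1_inj ->.
have no_exc u v s : chart_pt c0 u v <> Exc (Center c0 x0 y0) s.
  by move/chart_pt_Exc/(@blown_in_irr (Center c0 x0 y0)).
case: d; have [->|b0] := eqVneq b 0; have [->|b'0] := eqVneq b' 0.
- by move=> [/(@inP1_inj true) ->].
- by move/esym/no_exc.
- by move/no_exc.
- move/IH => [/addrI eb /addrI eab]; move: eab; rewrite eb.
  by move/(mulIf b'0).
- by case=> ->.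
- by move/esym/no_exc.
- by move/no_exc.
- move/IH => [/addrI eab /addrI eb]; move: eab; rewrite eb.
  by move/(mulIf b'0).
Qed.

Lemma chart_pt_u q a b : cy q = 0 -> b != 0 ->
  chart_pt (chart_u q) a b = chart_pt (cchart q) (cx q + a * b) b.
Proof. by move=> /= -> /negbTE ->; rewrite add0r. Qed.

Lemma chart_pt_U q a b : cy q = 0 -> b != 0 ->
  chart_pt (chart_U q) a b = chart_pt (cchart q) (cx q + b) (a * b).
Proof. by move=> /= -> /negbTE ->; rewrite add0r. Qed.

Lemma chart_pt_u0 q a : chart_pt (chart_u q) a 0 = Exc q (Some a).
Proof. by rewrite /= eqxx; case: q. Qed.

Lemma sub_proper_transform s (A : set (spoint K)) :
  A `&` blowup s `<=` proper_transform s A.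
Proof. by move=> x Ax; split; [case: Ax | move=> c h _ hx; exists x]. Qed.

Lemma proper_transform_out s c h a b (A : set (spoint K)) :
  is_chart s c -> ev h a b != 0 ->
  (forall a' b', ev h a' b' != 0 -> ~ A (chart_pt c a' b')) ->
  ~ proper_transform s A (chart_pt c a b).
Proof.
move=> cs hab hA [xs /(_ c h cs)] [|y [_ [a' [b' [hab' ->]]]] []].
  by split=> //; exists a, b.
by move/(hA _ _ hab').
Qed.

(** A coarse record of the exceptional curve on which a point lies, enough to show that a center is
    not on a given curve. *)
Definition pshape (x : spoint K) : option (seq bool) :=
  if x is Exc q _ then Some (chart_shape (cchart q)) else None.

Lemma pshape_center q : cy q = 0 ->
  pshape (center_pt q) =
  if cchart q is BlChart _ c0 _ _ then Some (chart_shape c0) else None.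
Proof.
by case: q => -[//|[] c0 x0 y0] x y /= ->; rewrite /center_pt /= eqxx.
Qed.

End Charts.

(** * Evaluation and partial derivatives of bivariate polynomials *)

Section Eval.
Variable K : fieldType.
Implicit Types (h : {poly {poly K}}) (a b : K).

Definition polyK (c : K) : {poly {poly K}} := c%:P%:P.
Definition polyY : {poly {poly K}} := ('X)%:P.

Lemma evD h1 h2 a b : ev (h1 + h2) a b = ev h1 a b + ev h2 a b.
Proof. by rewrite /ev !hornerE. Qed.
Lemma evN h a b : ev (- h) a b = - ev h a b.
Proof. by rewrite /ev !hornerE. Qed.
Lemma evM h1 h2 a b : ev (h1 * h2) a b = ev h1 a b * ev h2 a b.
Proof. by rewrite /ev !hornerE. Qed.
Lemma evXn h n a b : ev (h ^+ n) a b = ev h a b ^+ n.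
Proof. by rewrite /ev !horner_exp. Qed.
Lemma evC c a b : ev (polyK c) a b = c.
Proof. by rewrite /ev !hornerE. Qed.
Lemma evX a b : ev 'X a b = a.
Proof. by rewrite /ev !hornerE. Qed.
Lemma evY a b : ev polyY a b = b.
Proof. by rewrite /ev !hornerE. Qed.
Lemma ev1 a b : ev 1 a b = 1.
Proof. by rewrite /ev !hornerE. Qed.

Lemma ev0 a b : ev 0 a b = 0.
Proof. by rewrite /ev !hornerE. Qed.

Definition evE := (ev0, evD, evN, evXn, evM, evC, evX, evY, ev1).

Lemma dXM h1 h2 : dX (h1 * h2) = dX h1 * h2 + h1 * dX h2.
Proof. exact: derivM. Qed.

Lemma dYM h1 h2 : dY (h1 * h2) = dY h1 * h2 + h1 * dY h2.
Proof.
apply/polyP => i; rewrite /dY coefD coef_map_id0 ?raddf0// !coefM raddf_sum.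
rewrite -big_split; apply: eq_bigr => j _ /=.
by rewrite derivM !coef_map_id0 ?raddf0.
Qed.

Lemma dYD h1 h2 : dY (h1 + h2) = dY h1 + dY h2.
Proof.
by apply/polyP => i; rewrite /dY coefD !coef_map_id0 ?raddf0// coefD derivD.
Qed.

Lemma dXC c : dX (polyK c) = 0. Proof. exact: derivC. Qed.
Lemma dXX : dX ('X : {poly {poly K}}) = 1. Proof. exact: derivX. Qed.
Lemma dXY : dX polyY = 0. Proof. exact: derivC. Qed.
Lemma dY_polyC (r : {poly K}) : dY r%:P = (r^`())%:P.
Proof. by rewrite /dY map_polyC. Qed.
Lemma dYC c : dY (polyK c) = 0. Proof. by rewrite dY_polyC derivC. Qed.
Lemma dYY : dY polyY = 1. Proof. by rewrite dY_polyC derivX. Qed.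
Lemma dYX : dY ('X : {poly {poly K}}) = 0.
Proof.
apply/polyP => i; rewrite /dY coef_map_id0 ?raddf0// coefX coef0.
by case: eqP => _; [exact: derivC | rewrite deriv0].
Qed.

(** By the Leibniz rule a derivation sends v ^ 2 * M to a multiple of v, so the numerator of the
    quotient rule vanishes at v = 0. *)
Lemma dquot_vsq d M h a :
  (forall h1 h2, d (h1 * h2) = d h1 * h2 + h1 * d h2) ->
  dquot d (polyY ^+ 2 * M) h (a, 0) = 0.
Proof.
move=> dM; rewrite /dquot expr2 !dM /= !evE.
by rewrite !(mul0r, mulr0, add0r, addr0, subrr, oppr0).
Qed.

Lemma jacobian_vsq1 M N h a : jacobian (polyY ^+ 2 * M) N h (a, 0) = 0.
Proof.
by rewrite /jacobian (dquot_vsq _ _ _ dXM) (dquot_vsq _ _ _ dYM) !mul0r subrr.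
Qed.

Lemma jacobian_vsq2 M N h a : jacobian N (polyY ^+ 2 * M) h (a, 0) = 0.
Proof.
by rewrite /jacobian (dquot_vsq _ _ _ dXM) (dquot_vsq _ _ _ dYM) !mulr0 subrr.
Qed.

End Eval.

(** * Density arguments over an infinite field, and last exceptional curves *)

Lemma horner_neq0 (R : idomainType) (F : nat -> R) (p : {poly R}) :
  injective F -> p != 0 -> exists n, p.[F n] != 0.
Proof.
move=> Fi p0; apply: contrapT => noroot.
suff : (size [seq F i | i <- iota 0 (size p)] < size p)%N.
  by rewrite size_map size_iota ltnn.
apply: max_poly_roots => //; last by rewrite map_inj_uniq ?iota_uniq.
apply/allP => _ /mapP[n _ ->]; apply/negPn/negP => Fn.
by apply: noroot; exists n.
Qed.

Section InfiniteField.
Variable K : numFieldType.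
Implicit Types (h : {poly {poly K}}) (s : seq (center K)) (q : center K).

Lemma natr_inj : injective (fun n : nat => n%:R : K).
Proof. by move=> m n /eqP; rewrite eqr_nat => /eqP. Qed.

Lemma ev_neq0 h : h != 0 -> exists a b, ev h a b != 0.
Proof.
move=> h0; have [|n hn] := @horner_neq0 _ (fun n => n%:R%:P) h _ h0.
  by move=> m n /polyC_inj/natr_inj.
by have [m hm] := horner_neq0 natr_inj hn; exists n%:R, m%:R.
Qed.

(** Turns equalities of values on a dense open set into polynomial identities, which can be
    differentiated. *)
Lemma ev_inj h1 h2 h : h != 0 ->
  (forall a b, ev h a b != 0 -> ev h1 a b = ev h2 a b) -> h1 = h2.
Proof.
move=> h0 h12; apply/eqP; rewrite -subr_eq0; apply/negPn/negP => h12_neq0.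
have /ev_neq0[a [b]] : (h1 - h2) * h != 0 by rewrite mulf_neq0.
rewrite evM mulf_eq0 negb_or => /andP[+ /h12 e].
by rewrite evD evN e subrr eqxx.
Qed.

Lemma avoid (T : Type) (F : K -> T) (p : {poly K}) (l : seq T) :
  injective F -> p != 0 ->
  exists b, p.[b] != 0 /\ forall y, List.In y l -> F b <> y.
Proof.
move=> Fi; elim: l p => [|y l IH] p p0.
  by have [n pn] := horner_neq0 natr_inj p0; exists n%:R.
(* The only parameter that [F] could send to [y]; if there is none, the default 0 merely excludes
   one more value. *)
pose c := xget 0 [set b | F b = y].
have [|b [+ bl]] := IH (p * ('X - c%:P)).
  by rewrite mulf_neq0 ?polyXsubC_eq0.
rewrite hornerM mulf_eq0 negb_or !hornerE subr_eq0 => /andP[pb bc].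
exists b; split=> // z [<- Fb|/bl//].
move/eqP: bc; apply; apply: Fi; rewrite Fb; apply: esym.
by apply: (@xgetPex _ 0 [set b | F b = y]); exists b.
Qed.

(* Comparing shapes gives a decidable sufficient condition for no center of s *)
(* to lie on, or over, the exceptional curve of q.                            *)
Definition leaf s q : bool :=
  all (fun r => ~~ suffix (chart_shape (cchart q)) (behead (chart_shape (cchart r)))) s.

Lemma all_In (T : Type) (P : pred T) (l : seq T) x : all P l -> List.In x l -> P x.
Proof. by elim: l => //= y l IH /andP[Py /IH lP] [<-|/lP]. Qed.

Lemma leaf_blowup s q u : (forall r, List.In r s -> cy r = 0) ->
  leaf s q -> List.In q s -> blowup s (Exc q u).
Proof.
move=> s0 lf qs; split=> // r rs /(congr1 (@pshape K)) /=.
rewrite (pshape_center (s0 _ rs)); have := all_In lf rs.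
by case: (cchart r) => //= _ c0 _ _ + [e]; rewrite e suffix_refl.
Qed.

(** No center lies over the curve of q, so only the two charts of q see this curve, and the chart
    (u, v) misses its point at infinity. *)
Lemma leaf_chart_None s q c a b : leaf s q -> is_chart s c ->
  chart_pt c a b = Exc q None -> [/\ c = chart_U q, a = 0 & b = 0].
Proof.
move=> lf; case: c => [//|d c x0 y0] cs E.
case: (chart_pt_Exc E) => [qc|/blown_in_suffix]; last by rewrite (negbTE (all_In lf cs)).
have irr u v : chart_pt c u v <> Exc q None.
  by rewrite qc => /chart_pt_Exc/(@blown_in_irr _ (Center c x0 y0)).
case: d E {cs} => /=; case: eqP => [->|_] E; try by case: (irr _ _ E).
  by case: E; rewrite qc; case: eqP => // -> _.
by case: E.
Qed.

(* The point at infinity of a last exceptional curve, whose center lies on an *)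
(* exceptional curve, is the intersection of these two curves.                *)
Lemma Exc_None_closure s d c0 x0 y0 x :
  let q := Center (BlChart d c0 x0 y0) x 0 in
  leaf s q -> List.In (Center c0 x0 y0) s -> blowup s (Exc q None) ->
  proper_transform s (exc_curve (Center c0 x0 y0)) (Exc q None).
Proof.
move=> q lf q's xs; split=> // c h cs [_ [a [b [hab E]]]].
have [Ec a0 b0] := leaf_chart_None lf cs (esym E).
subst a b c.
(* [F] parametrizes the line U = 0 of [chart_U q], which is the previous exceptional curve. *)
pose F b := Exc (Center c0 x0 y0) (inP1 d (x + b)).
have Fi : injective F by move=> b b' [/inP1_inj/addrI].
have h0 : h.[0%:P] * 'X != 0.
  (* The factor 'X excludes b = 0, where the chart gives the point at infinity itself. *)
  by rewrite mulf_neq0 ?polyX_eq0//; apply: contraNneq hab; rewrite /ev => ->; rewrite horner0.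
have [b [+ Fb]] := avoid (map (@center_pt K) s) Fi h0.
rewrite hornerM hornerX mulf_eq0 negb_or => /andP[hb b0].
have Ebl : blowup s (F b).
  by split=> // r rs; apply: Fb; apply: List.in_map.
exists (F b); last by split=> //; exists (inP1 d (x + b)).
split=> //; exists 0, b; split=> //=.
by rewrite (negbTE b0) mul0r addr0 eqxx /F; case: (d).
Qed.

End InfiniteField.

(** * Finite sets are closed, and finite fibres exclude contracted curves *)

Section FiniteClosed.
Variable K : fieldType.
Implicit Types (s : seq (center K)) (W A : set (spoint K)).

(** The polynomial is a product of linear factors, one for each listed point in the chart, in a
    coordinate that distinguishes it from (a, b). *)
Lemma separate c a b (l : seq (spoint K)) :
  (forall y, List.In y l -> y <> chart_pt c a b) ->
  exists2 h, ev h a b != 0 &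
    forall a' b', ev h a' b' != 0 -> ~ List.In (chart_pt c a' b') l.
Proof.
elim: l => [|y l IH] yl; first by exists 1; [rewrite ev1 oner_eq0 | move=> ? ? _ []].
have [|h hab hl] := IH; first by move=> z zl; apply: yl; right.
have yab := yl y (or_introl erefl).
have [[a0 [b0 yE]]|noy] := pselect (exists a0 b0, y = chart_pt c a0 b0); last first.
  exists h => // a' b' h' [yE|]; last exact: hl.
  by apply: noy; exists a', b'.
have [k kab k0] : exists2 k, ev k a b != 0 & ev k a0 b0 = 0.
  have [ea|na] := eqVneq a a0; last first.
    by exists ('X - polyK a0); rewrite !evE ?subr_eq0 ?subrr.
  have [eb|nb] := eqVneq b b0; last first.
    by exists (polyY K - polyK b0); rewrite !evE ?subr_eq0 ?subrr.
  by case: yab; rewrite yE ea eb.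
exists (h * k); first by rewrite evM mulf_neq0.
move=> a' b'; rewrite evM mulf_eq0 negb_or => /andP[h' k'] [|]; last exact: hl.
by rewrite yE => /chart_pt_inj[ea eb]; rewrite -ea -eb k0 eqxx in k'.
Qed.

Lemma finite_closed_in s W A : W `<=` blowup s ->
  (forall x, W x -> is_chart s (chart_at x)) ->
  finite_set A -> A `<=` W -> closed_in s W A.
Proof.
move=> Ws Wc Afin AW; split=> // x [[xs xA] Wx]; apply: contrapT => nAx.
have [l lA] : exists l, forall y, List.In y l <-> A y.
  case/finite_setP: Afin => n; elim: n A AW {xA nAx} => [|n IH] A AW.
    by rewrite II0 card_eq0 => /eqP->; exists [::].
  move=> /eq_cardSP[y Ay /IH[z []/AW//|l lE]].
  exists (y :: l) => z /=; split=> [[<-//|/lE[]//]|Az].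
  by have [->|zy] := pselect (y = z); [left | right; apply/lE; split=> // /esym].
have [y /lA Ay E|h hx hl] := @separate (chart_at x) (coord_at x).1 (coord_at x).2 l.
  by apply: nAx; rewrite chart_atK in E; rewrite -E.
have [|y [_ [a [b [hab yE]]]] Ay] := xA _ h (Wc _ Wx).
  by split=> //; exists (coord_at x).1, (coord_at x).2; rewrite chart_atK.
by apply: (hl _ _ hab); rewrite -yE; apply/lA.
Qed.

Lemma critical_locus_finite_fibres s W (phi : spoint K -> spoint K) :
  W `<=` blowup s -> (forall x, W x -> is_chart s (chart_at x)) ->
  (forall y, finite_set (W `&` phi @^-1` [set y])) ->
  critical_locus s W phi = set0.
Proof.
move=> Ws Wc fin; apply/seteqP; split=> // x [A /= [[]]].
move=> [[AW _] [a Aa] Airr] [B [[BW _] [b Bb] _] BA] _ [y fA] _.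
have Afin : finite_set A.
  apply: sub_finite_set (fin y) => z Az; split; first exact: AW.
  by have : [set y] (phi z) by rewrite -fA; exists z.
have cl C : C `<=` A -> closed_in s W C.
  move=> CA; apply: finite_closed_in => //; first exact: sub_finite_set Afin.
  by move=> z /CA/AW.
(* All subsets of the finite set A are closed, so irreducibility forces A = {a}, leaving no room for
   the smaller nonempty B. *)
have [|||Asub|/(_ a Aa)[_]] := Airr [set a] (A `\ a); last by apply.
- by apply: cl => _ ->.
- by apply: cl => z [].
- by move=> z Az; have [->|] := pselect (z = a); [left | right].
case: BA => BA nAB; apply: nAB => z /Asub ->.
by rewrite -(Asub b (BA _ Bb)).
Qed.

End FiniteClosed.

(** * The Okamoto surface away from D *)

Section OkamotoSurface.
Variables (K : numFieldType) (t a1 a2 : K).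
Local Notation s := (ok_centers t a1 a2).
Local Notation ok2 := (ok2 a2).
Local Notation ok4 := (ok4 a1).
Local Notation ok7 := (ok7 t).
Local Notation ok8 := (ok8 t a1 a2).

Definition ok_good (x : spoint K) : Prop :=
  match x with
  | Base (Some _) (Some _) => True
  | Exc c (Some _) => List.In c [:: ok2; ok4; ok8]
  | _ => False
  end.

Lemma chart_ok2 u v : chart_pt (chart_u ok2) u v =
  if v == 0 then Exc ok2 (Some u) else Base (Some v^-1) (Some (v * (- a2 + u * v))).
Proof.
have [->|v0] := eqVneq v 0; first by rewrite chart_pt_u0.
rewrite chart_pt_u // chart_pt_U //= /inP1 add0r (negbTE v0).
by rewrite mulrC.
Qed.

Lemma chart_ok4 u v : chart_pt (chart_u ok4) u v =
  if v == 0 then Exc ok4 (Some u) else Base (Some ((a1 + u * v) * v)) (Some v^-1).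
Proof.
have [->|v0] := eqVneq v 0; first by rewrite chart_pt_u0.
by rewrite !chart_pt_u //= /inP1 (negbTE v0) add0r.
Qed.

(* Near E_8, 1 / f = v and 1 / g = v * Gok8.                                  *)
Definition Gok8 : {poly {poly K}} :=
  polyK 2 - polyK (4 * t) * polyY K + polyK (4 * (1 - a1 - a2 + 2 * t ^+ 2)) * polyY K ^+ 2
  + 'X * polyY K ^+ 3.

Lemma ev_G8 u v : ev Gok8 u v =
  2 - 4 * t * v + 4 * (1 - a1 - a2 + 2 * t ^+ 2) * v ^+ 2 + u * v ^+ 3.
Proof. by rewrite /Gok8 !evE. Qed.

Lemma chart_ok8 u v : chart_pt (chart_u ok8) u v =
  if v == 0 then Exc ok8 (Some u)
  else Base (Some v^-1) (inP1 true (v * ev Gok8 u v)).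
Proof.
have [->|v0] := eqVneq v 0; first by rewrite chart_pt_u0.
rewrite !chart_pt_u // chart_pt_U //= /inP1 !add0r (negbTE v0).
by rewrite ev_G8; do 2 (congr Base || congr (if _ == 0 then _ else Some _^-1)); ring.
Qed.

(** Good points form an open set; near E_8 the condition [Gok8] != 0 keeps g finite. *)
Lemma ok_good_nbhd x : ok_good x -> exists c h a b,
  [/\ is_chart s c, x = chart_pt c a b, ev h a b != 0 &
      forall a' b', ev h a' b' != 0 -> ok_good (chart_pt c a' b')].
Proof.
case: x => [[f|] [g|]|c [u|]] //=.
  by exists (AffChart K false false), 1, f, g; split=> //; rewrite ev1 oner_eq0.
move=> [<-|[<-|[<-|//]]].
- exists (chart_u ok2), 1, u, 0; split=> //; rewrite ?chart_pt_u0 ?ev1 ?oner_eq0//.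
  + by right; left.
  + by move=> a b _; rewrite chart_ok2; case: eqP => //= _; left.
- exists (chart_u ok4), 1, u, 0; split=> //; rewrite ?chart_pt_u0 ?ev1 ?oner_eq0//.
  + by do 3 right; left.
  + by move=> a b _; rewrite chart_ok4; case: eqP => //= _; right; left.
- exists (chart_u ok8), Gok8, u, 0; split=> //; rewrite ?chart_pt_u0 //.
  + by do 7 right; left.
  + by rewrite ev_G8 !(mulr0, expr0n, addr0) subr0 pnatr_eq0.
  + move=> a b hab; rewrite chart_ok8; case: eqP => /= [_|/eqP b0].
      by do 2 right; left.
    by rewrite /inP1 mulf_eq0 (negbTE hab) (negbTE b0).
Qed.

Lemma ok_leaves c : List.In c [:: ok2; ok4; ok8] -> leaf s c.
Proof. by move=> [<-|[<-|[<-|//]]]. Qed.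

Lemma ok_good_out A : (forall x, ok_good x -> ~ A x) ->
  forall x, ok_good x -> ~ proper_transform s A x.
Proof.
move=> gA x /ok_good_nbhd[c [h [a [b [cs -> hab hg]]]]].
by apply: proper_transform_out cs hab _ => a' b' /hg/gA.
Qed.

(** The test [leaf] computes to true on the first list and to false on the second, whatever the
    parameters. *)
Lemma ok_inner c q : List.In c [:: ok2; ok4; ok8] ->
  List.In q [:: ok1 K; ok3 K; ok5 K; ok6 K; ok7] -> c <> q.
Proof.
move=> /ok_leaves lf qi cq; move: lf; rewrite cq; apply/negP.
exact: (@all_In _ (predC (leaf s)) _ _ _ qi).
Qed.

(** The points at infinity of the last curves are in D by [Exc_None_closure]; good points are
    outside D because they have neighbourhoods of good points, which avoid the curves defining D. *)
Lemma ok_goodE : ok_X t a1 a2 `\` ok_D t a1 a2 = ok_good.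
Proof.
have s0 : forall r, List.In r s -> cy r = 0.
  by move=> r; do 8 (case=> [<- //|]).
apply/seteqP; split=> x.
- move=> [xs nD].
  have nxN : ~ line_x None x by move=> h; apply: nD; left; left; apply: sub_proper_transform.
  have nyN : ~ line_y None x by move=> h; apply: nD; left; right; apply: sub_proper_transform.
  case: x xs nD nxN nyN => [[f|] [g|]|c u] xs nD nxN nyN //=.
  + by apply: nyN; exists (Some f).
  + by apply: nxN; exists (Some g).
  + by apply: nxN; exists None.
  have ninner : ~ List.In c [:: ok1 K; ok3 K; ok5 K; ok6 K; ok7].
    move=> ci; apply: nD; right; exists c => //.
    by apply: sub_proper_transform; split=> //; exists u.
  have cl : List.In c [:: ok2; ok4; ok8].
    have := xs.1; move: ninner => /=; tauto.
  case: u xs nD {nxN nyN} => [//|] xs nD; exfalso; apply: nD; right.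
  have lf := ok_leaves cl; case: cl => [cE|[cE|[cE|//]]]; subst c.
  + exists (ok1 K); [by left | apply: Exc_None_closure => //; by left].
  + by exists (ok3 K); [by right; left | apply: Exc_None_closure => //; do 2 right; left].
  + by exists ok7; [do 4 right; left | apply: Exc_None_closure => //; do 6 right; left].
- move=> xg; split.
    case: x xg => [[f|] [g|]|c [u|]] //= cl; last first.
      apply: leaf_blowup => //; first exact: ok_leaves.
      by case: cl => [<-|[<-|[<-|//]]] /=; tauto.
    split=> // q; do 8 (case=> [<-|]; first by rewrite /center_pt /= ?eqxx).
    by [].
  move=> [[|]|[q qi]]; apply: ok_good_out xg => -[[f|] [g|]|c [u|]] //=; try by move=> _ [].
  by move=> /ok_inner/(_ qi) cq [s' [/cq]].
Qed.

End OkamotoSurface.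

(** * The Takasaki surface away from D *)

Section TakasakiSurface.
Variables (K : numFieldType) (t a1 a2 : K).
Hypothesis a1_neq0 : a1 != 0.
Local Notation s := (tak_centers t a1 a2).
Local Notation tak3 := (tak3 a1).
Local Notation tak5 := (tak5 a1).
Local Notation tak14 := (tak14 t a1 a2).
Local Notation tak20 := (tak20 t a1 a2).
Local Notation leaves := [:: tak3; tak5; tak14; tak20].
Local Notation inner :=
  [:: tak1 K; tak2 a1; tak4 a1; tak6 K; tak7 K; tak8 K; tak9 K; tak10 K;
      tak11 t; tak12 t; tak13 t a1 a2; tak15 K; tak16 K; tak17 t; tak18 t;
      tak19 t a1 a2].

Definition tak_good (x : spoint K) : Prop :=
  match x with
  | Base (Some q) (Some _) => q != 0
  | Exc c (Some _) => List.In c leaves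
  | _ => False
  end.

(* Near the exceptional curves of q_3 and q_5, q = v * qlow and 1 / p = v.    *)
(* Here and below, locking keeps the rewrite rules evE from unfolding.        *)
Definition qlow (c : K) : {poly {poly K}} := locked (polyK c + 'X * polyY K ^+ 2).

Lemma ev_qlow c u v : ev (qlow c) u v = c + u * v ^+ 2.
Proof. by rewrite /qlow -lock !evE. Qed.

Lemma ev_qlow0 c u : ev (qlow c) u 0 = c.
Proof. by rewrite ev_qlow; ring. Qed.

Lemma chart_tak_low c u v :
  let q := Center (chart_u (Center (chart_u (tak1 K)) c 0)) 0 0 in
  chart_pt (chart_u q) u v =
  if v == 0 then Exc q (Some u) else Base (Some (ev (qlow c) u v * v)) (Some v^-1).
Proof.
move=> q; have [->|v0] := eqVneq v 0; first by rewrite chart_pt_u0.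
rewrite !chart_pt_u //= /inP1 (negbTE v0) ev_qlow.
by congr (Base (Some _) _); ring.
Qed.

(* Near the exceptional curves of q_14 and q_20, 1 / q = v and               *)
(* 1 / p = v ^ 3 * Phigh.                                                     *)
Definition Phigh (e0 e1 e2 : K) : {poly {poly K}} :=
  locked (polyK e0 + polyK e1 * polyY K ^+ 2 + polyK e2 * polyY K ^+ 4 + 'X * polyY K ^+ 6).

Definition Phigh14 :=
  Phigh 8 (- (64 * t)) (256 * (2 + 2 * t ^+ 2 - a1 - 2 * a2)).
Definition Phigh20 :=
  Phigh (- 8) (64 * t) (- (256 * (2 * t ^+ 2 - a1 - 2 * a2))).

Lemma ev_Phigh e0 e1 e2 u v :
  ev (Phigh e0 e1 e2) u v = e0 + e1 * v ^+ 2 + e2 * v ^+ 4 + u * v ^+ 6.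
Proof. by rewrite /Phigh -lock !evE. Qed.

Lemma ev_Phigh0 e0 e1 e2 u : ev (Phigh e0 e1 e2) u 0 = e0.
Proof. by rewrite ev_Phigh; ring. Qed.

Lemma chart_tak_high e0 e1 e2 u v :
  let q9 := Center (chart_u (tak8 K)) e0 0 in
  let q10 := Center (chart_u q9) 0 0 in
  let q11 := Center (chart_u q10) e1 0 in
  let q12 := Center (chart_u q11) 0 0 in
  let q13 := Center (chart_u q12) e2 0 in
  let q := Center (chart_u q13) 0 0 in
  chart_pt (chart_u q) u v =
  if v == 0 then Exc q (Some u)
  else Base (Some v^-1) (inP1 true (v ^+ 3 * ev (Phigh e0 e1 e2) u v)).
Proof.
move=> q9 q10 q11 q12 q13 q.
have [->|v0] := eqVneq v 0; first by rewrite chart_pt_u0.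
rewrite !chart_pt_u // chart_pt_U //= /inP1 !add0r (negbTE v0) ev_Phigh.
by do 2 (congr Base || congr (if _ == 0 then _ else Some _^-1)); ring.
Qed.

Lemma chart_tak3 u v : chart_pt (chart_u tak3) u v =
  if v == 0 then Exc tak3 (Some u)
  else Base (Some (ev (qlow (4 * a1)) u v * v)) (Some v^-1).
Proof. exact: chart_tak_low. Qed.

Lemma chart_tak5 u v : chart_pt (chart_u tak5) u v =
  if v == 0 then Exc tak5 (Some u)
  else Base (Some (ev (qlow (- (4 * a1))) u v * v)) (Some v^-1).
Proof. exact: chart_tak_low. Qed.

Lemma chart_tak14 u v : chart_pt (chart_u tak14) u v =
  if v == 0 then Exc tak14 (Some u)
  else Base (Some v^-1) (inP1 true (v ^+ 3 * ev Phigh14 u v)).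
Proof. exact: chart_tak_high. Qed.

Lemma chart_tak20 u v : chart_pt (chart_u tak20) u v =
  if v == 0 then Exc tak20 (Some u)
  else Base (Some v^-1) (inP1 true (v ^+ 3 * ev Phigh20 u v)).
Proof. exact: chart_tak_high. Qed.

Lemma tak_leaves_centers c : List.In c leaves -> List.In c s.
Proof. by move=> /= cl; intuition. Qed.

Lemma tak_leaves c : List.In c leaves -> leaf s c.
Proof. by move=> [<-|[<-|[<-|[<-|//]]]]. Qed.

(** Near q_3 and q_5 the neighbourhood [qlow] != 0 keeps q nonzero, and it contains the curve v = 0
    because a1 != 0; near q_14 and q_20 [Phigh] != 0 keeps p finite. *)
Lemma tak_good_nbhd x : tak_good x -> exists c h a b,
  [/\ is_chart s c, x = chart_pt c a b, ev h a b != 0 &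
      forall a' b', ev h a' b' != 0 -> tak_good (chart_pt c a' b')].
Proof.
case: x => [[q|] [p|]|c [u|]] //=.
  by move=> q0; exists (AffChart K false false), 'X, q, p; rewrite evX;
    split=> // a' b'; rewrite evX.
move=> cl; exists (chart_u c).
have cs : is_chart s (chart_u c).
  by case: c cl => c x y /tak_leaves_centers.
have a40 : 4 * a1 != 0 by rewrite mulf_neq0 ?pnatr_eq0.
have [cE|[cE|[cE|[cE|//]]]] := cl; subst c.
- exists (qlow (4 * a1)), u, 0; rewrite chart_pt_u0 ev_qlow0; split=> // a b hab.
  rewrite chart_tak3; case: eqP => [_|/eqP b0]; first exact: cl.
  by rewrite /= mulf_neq0.
- exists (qlow (- (4 * a1))), u, 0; rewrite chart_pt_u0 ev_qlow0 oppr_eq0; split=> // a b hab.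
  rewrite chart_tak5; case: eqP => [_|/eqP b0]; first exact: cl.
  by rewrite /= mulf_neq0.
- exists Phigh14, u, 0; rewrite chart_pt_u0 ev_Phigh0 pnatr_eq0; split=> // a b hab.
  rewrite chart_tak14; case: eqP => [_|/eqP b0]; first exact: cl.
  by rewrite /inP1 mulf_eq0 expf_eq0 (negbTE hab) (negbTE b0) /= invr_eq0.
- exists Phigh20, u, 0; rewrite chart_pt_u0 ev_Phigh0 oppr_eq0 pnatr_eq0; split=> // a b hab.
  rewrite chart_tak20; case: eqP => [_|/eqP b0]; first exact: cl.
  by rewrite /inP1 mulf_eq0 expf_eq0 (negbTE hab) (negbTE b0) /= invr_eq0.
Qed.

Lemma tak_good_out A : (forall x, tak_good x -> ~ A x) ->
  forall x, tak_good x -> ~ proper_transform s A x.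
Proof.
move=> gA x /tak_good_nbhd[c [h [a [b [cs -> hab hg]]]]].
by apply: proper_transform_out cs hab _ => a' b' /hg/gA.
Qed.

Lemma tak_inner c q : List.In c leaves -> List.In q inner -> c <> q.
Proof.
move=> /tak_leaves lf qi cq; move: lf; rewrite cq; apply/negP.
exact: (@all_In _ (predC (leaf s)) _ _ _ qi).
Qed.

Lemma tak_good_blowup x : tak_good x -> blowup s x.
Proof.
case: x => [[q|] [p|]|c [u|]] //= cl.
  by split=> // r; do 20 (case=> [<-|]; first by rewrite /center_pt /= ?eqxx).
apply: leaf_blowup; last exact: tak_leaves_centers.
  by move=> r; do 20 (case=> [<- //|]).
exact: tak_leaves.
Qed.

Lemma tak_goodE : tak_X t a1 a2 `\` tak_D t a1 a2 = tak_good.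
Proof.
have s0 : forall r, List.In r s -> cy r = 0.
  by move=> r; do 20 (case=> [<- //|]).
apply/seteqP; split=> x.
- move=> [xs nD].
  have nx0 : ~ line_x (Some 0) x.
    by move=> h; apply: nD; left; left; left; apply: sub_proper_transform.
  have nxN : ~ line_x None x by move=> h; apply: nD; left; left; right; apply: sub_proper_transform.
  have nyN : ~ line_y None x by move=> h; apply: nD; left; right; apply: sub_proper_transform.
  case: x xs nD nx0 nxN nyN => [[q|] [p|]|c u] xs nD nx0 nxN nyN //=.
  + by apply: contra_notN nx0 => /eqP ->; exists (Some p).
  + by apply: nyN; exists (Some q).
  + by apply: nxN; exists (Some p).
  + by apply: nxN; exists None.
  have ninner : ~ List.In c inner.
    move=> ci; apply: nD; right; exists c => //.
    by apply: sub_proper_transform; split=> //; exists u.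
  have cl : List.In c leaves.
    have := xs.1; move: ninner => /=; tauto.
  case: u xs nD {nx0 nxN nyN} => [//|] xs nD; exfalso; apply: nD; right.
  have lf := tak_leaves cl; case: cl => [cE|[cE|[cE|[cE|//]]]]; subst c.
  + by exists (tak2 a1); [right; left | apply: Exc_None_closure => //; right; left].
  + by exists (tak4 a1); [do 2 right; left | apply: Exc_None_closure => //; do 3 right; left].
  + by exists (tak13 t a1 a2); [do 10 right; left |
        apply: Exc_None_closure => //; do 12 right; left].
  + by exists (tak19 t a1 a2); [do 15 right; left |
        apply: Exc_None_closure => //; do 18 right; left].
- move=> xg; split; first exact: tak_good_blowup.
  move=> [[[|]|]|[q qi]]; apply: tak_good_out xg => -[[f|] [g|]|c [u|]] //=; try by move=> _ [].
    by move=> f0 [b [fE]]; rewrite fE eqxx in f0.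
  by move=> /tak_inner/(_ qi) cq [s' [/cq]].
Qed.

End TakasakiSurface.

(** * The map and its local expressions *)

Section Phi.
Variables (K : numFieldType) (t a1 a2 : K).
Hypothesis a1_neq0 : a1 != 0.
Local Notation tak3 := (tak3 a1).
Local Notation tak5 := (tak5 a1).
Local Notation tak14 := (tak14 t a1 a2).
Local Notation tak20 := (tak20 t a1 a2).
Local Notation ok2 := (ok2 a2).
Local Notation ok4 := (ok4 a1).
Local Notation ok8 := (ok8 t a1 a2).
Local Notation sT := (tak_centers t a1 a2).
Local Notation sO := (ok_centers t a1 a2).
Local Notation good := (tak_good t a1 a2).
Local Notation W3 := (qlow (4 * a1)).
Local Notation W5 := (qlow (- (4 * a1))).
Local Notation Phigh14 := (Phigh14 t a1 a2).
Local Notation Phigh20 := (Phigh20 t a1 a2).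
Local Notation polyY := (polyY K).

(* g = T3 / (2 * v ^ 2 * qlow ^ 2) *)
Definition T3 : {poly {poly K}} :=
  locked (polyK t * polyY ^+ 2 * W3 ^+ 2 + polyK (4 * a1) + W3
  + polyK (1 / 8) * polyY ^+ 4 * W3 ^+ 4).
(** At E_4 the coordinates are g * (f * g - a1) and 1 / g; an extra factor [T3] in the numerator
    gives both the denominator [den3]. *)
Definition num3 : {poly {poly K}} :=
  (polyK (1 / 8) * 'X + polyK (t / 8) * W3 ^+ 2
   + polyK (1 / 64) * polyY ^+ 2 * W3 ^+ 4) * T3 ^+ 2.
Definition den3 : {poly {poly K}} := polyK 2 * W3 ^+ 2 * T3.
Definition sq3 : {poly {poly K}} := polyK 4 * W3 ^+ 4.

(** At q_5 the poles of 2 * a1 / q ^ 2 and p / (2 * q) cancel, since 4 * a1 + [W5] = u * v ^ 2, so g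
    stays finite. *)
Definition num5 : {poly {poly K}} :=
  polyK (8 * t) * W5 ^+ 2 + polyK 8 * 'X + polyY ^+ 2 * W5 ^+ 4.
Definition den5 : {poly {poly K}} := polyK 16 * W5 ^+ 2.
Definition sq5 : {poly {poly K}} := polyK 4 * W5 ^+ 4.

(* g = T14 / (4 * v ^ 2 * Phigh14) *)
Definition T14 : {poly {poly K}} :=
  locked (polyK 2
  + Phigh14 * (polyK (1 / 4) + polyK (2 * t) * polyY ^+ 2 + polyK (8 * a1) * polyY ^+ 4)).
Definition c14 : K := 256 * (2 + 2 * t ^+ 2 - a1 - 2 * a2).
Definition c8 : K := 4 * (1 - a1 - a2 + 2 * t ^+ 2).
(** [l2], [l3], [l4] are the coefficients of v ^ 4, v ^ 6, v ^ 8 in (1 / 4 + 2 * t * v ^ 2 + 8 * a1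
    * v ^ 4) * (2 - 4 * t * v' + c8 * v' ^ 2) with v' = 4 * v ^ 2; the coefficient of v ^ 2 is 0. *)
Definition l2 : K := 4 * c8 - 32 * t ^+ 2 + 16 * a1.
Definition l3 : K := 32 * t * c8 - 128 * t * a1.
Definition l4 : K := 128 * a1 * c8.
(* With v' = 4 * v ^ 2 the second coordinate at E_8, v ^ 6 * num14 is the     *)
(* difference Phigh14 - T14 * (2 - 4 * t * v' + c8 * v' ^ 2).                 *)
Definition num14 : {poly {poly K}} :=
  polyK (1 / 2) * 'X + polyK (64 * t * l2 - 8 * l3)
  + polyY ^+ 2 * polyK (64 * t * l3 - 8 * l4 - c14 * l2)
  + polyY ^+ 4 * (polyK (64 * t * l4 - c14 * l3) - polyK l2 * 'X)
  - polyY ^+ 6 * (polyK l3 * 'X + polyK (c14 * l4)) - polyY ^+ 8 * polyK l4 * 'X.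
Definition den14 : {poly {poly K}} := polyK 64 * T14.
Definition sq14 : {poly {poly K}} := polyK 256 * T14.

Definition c20 : K := - (256 * (2 * t ^+ 2 - a1 - 2 * a2)).
(** The term 16 * a2 comes from the center p_2: the coordinate at E_2 is f * (f * g + a2). *)
Definition k20 : K := 8 * a1 + 16 * a2.
(* v ^ 6 * num20 = 2 + Phigh20 * (1 / 4 + 2 * t * v ^ 2 + k20 * v ^ 4) *)
Definition num20 : {poly {poly K}} :=
  polyK (1 / 4) * 'X + polyK (2 * t * c20 + 64 * t * k20)
  + polyY ^+ 2 * (polyK (2 * t) * 'X + polyK (c20 * k20))
  + polyY ^+ 4 * polyK k20 * 'X.
Definition den20 : {poly {poly K}} := polyK 64 * Phigh20.
Definition sq20 : {poly {poly K}} := polyK 256 * Phigh20.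

(** On the last curves the value is that of the local expression at v = 0; the final branch serves
    q_20, and values at other points do not matter. *)
Definition phi (x : spoint K) : spoint K :=
  match x with
  | Base (Some q) (Some p) => Base (Some (phi_f q)) (Some (phi_g t a1 q p))
  | Exc c (Some u) =>
      if `[< c = tak3 >] then Exc ok4 (Some (ev num3 u 0 / ev den3 u 0))
      else if `[< c = tak5 >] then Base (Some 0) (Some (ev num5 u 0 / ev den5 u 0))
      else if `[< c = tak14 >] then Exc ok8 (Some (ev num14 u 0 / ev den14 u 0))
      else Exc ok2 (Some (ev num20 u 0 / ev den20 u 0))
  | _ => x
  end.

Lemma neq_shape (c c' : center K) : chart_shape (cchart c) != chart_shape (cchart c') -> c <> c'.
Proof. by move=> + cc; rewrite cc eqxx. Qed.

Lemma tak5_neq3 : tak5 <> tak3.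
Proof.
case=> /esym/eqP; rewrite -subr_eq0 opprK -mulrDl -natrD mulf_eq0.
by rewrite (negbTE a1_neq0) !pnatr_eq0.
Qed.

Lemma tak20_neq14 : tak20 <> tak14.
Proof.
by case=> /esym/eqP; rewrite -subr_eq0 opprK -natrD pnatr_eq0.
Qed.

Lemma phi_tak3 u : phi (Exc tak3 (Some u)) = Exc ok4 (Some (ev num3 u 0 / ev den3 u 0)).
Proof. by rewrite /phi asboolT. Qed.

Lemma phi_tak5 u :
  phi (Exc tak5 (Some u)) = Base (Some 0) (Some (ev num5 u 0 / ev den5 u 0)).
Proof. by rewrite /phi asboolF ?asboolT//; exact: tak5_neq3. Qed.

Lemma phi_tak14 u :
  phi (Exc tak14 (Some u)) = Exc ok8 (Some (ev num14 u 0 / ev den14 u 0)).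
Proof.
have n3 : tak14 <> tak3 by exact: neq_shape.
have n5 : tak14 <> tak5 by exact: neq_shape.
by rewrite /phi (asboolF n3) (asboolF n5) asboolT.
Qed.

Lemma phi_tak20 u :
  phi (Exc tak20 (Some u)) = Exc ok2 (Some (ev num20 u 0 / ev den20 u 0)).
Proof.
have n3 : tak20 <> tak3 by exact: neq_shape.
have n5 : tak20 <> tak5 by exact: neq_shape.
by rewrite /phi (asboolF n3) (asboolF n5) (asboolF tak20_neq14).
Qed.


Lemma ev_T3 u v : ev T3 u v = t * v ^+ 2 * ev W3 u v ^+ 2 + 4 * a1 + ev W3 u v
  + 1 / 8 * v ^+ 4 * ev W3 u v ^+ 4.
Proof. by rewrite /T3 -lock !evE. Qed.

Lemma ev_T14 u v : ev T14 u v =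
  2 + ev Phigh14 u v * (1 / 4 + 2 * t * v ^+ 2 + 8 * a1 * v ^+ 4).
Proof. by rewrite /T14 -lock !evE. Qed.



Lemma ev_den3_0 u : ev den3 u 0 = 256 * a1 ^+ 3.
Proof. by rewrite /den3 !evE ev_T3 ev_qlow0; field. Qed.

Lemma ev_den5_0 u : ev den5 u 0 = 256 * a1 ^+ 2.
Proof. by rewrite /den5 !evE ev_qlow0; ring. Qed.

Lemma ev_den14_0 u : ev den14 u 0 = 256.
Proof. by rewrite /den14 !evE ev_T14 ev_Phigh0; field. Qed.

Lemma ev_den20_0 u : ev den20 u 0 = - 512.
Proof. by rewrite /den20 !evE ev_Phigh0; ring. Qed.

(** The nonzero slope serves twice: injectivity for the fibres, and explicit preimages for the
    branch locus. *)
Lemma phi_affine3 u : ev num3 u 0 / ev den3 u 0 = u / (32 * a1) + a1 * t / 2.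
Proof.
by rewrite ev_den3_0 /num3 !evE ev_T3 ev_qlow0; field.
Qed.

Lemma phi_affine5 u : ev num5 u 0 / ev den5 u 0 = u / (32 * a1 ^+ 2) + t / 2.
Proof.
by rewrite ev_den5_0 /num5 !evE ev_qlow0; field.
Qed.

Lemma phi_affine14 u :
  ev num14 u 0 / ev den14 u 0 = u / 512 + (64 * t * l2 - 8 * l3) / 256.
Proof.
by rewrite ev_den14_0 /num14 !evE; field.
Qed.

Lemma phi_affine20 u :
  ev num20 u 0 / ev den20 u 0 = - u / 2048 - (2 * t * c20 + 64 * t * k20) / 512.
Proof.
by rewrite ev_den20_0 /num20 !evE; field.
Qed.

Lemma local_expr_base q p : q != 0 ->
  local_expr good phi (AffChart K false false) (q, p) (AffChart K false false)
    (polyK 4 * 'X ^+ 4)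
    (polyK (8 * t) * 'X ^+ 2 + polyK (32 * a1) + polyK 8 * 'X * polyY + 'X ^+ 4)
    (polyK 16 * 'X ^+ 2).
Proof.
move=> q0; split=> [|a b /= a0 _]; rewrite !evE /=.
  by rewrite mulf_neq0 ?expf_neq0 ?pnatr_eq0.
by rewrite /phi_f /phi_g; congr (Base (Some _) (Some _)); field.
Qed.

Lemma local_expr_tak3 u :
  local_expr good phi (chart_u tak3) (u, 0) (chart_u ok4) num3 (polyY ^+ 2 * sq3) den3.
Proof.
split=> [|a b]; first by rewrite ev_den3_0 mulf_neq0 ?expf_neq0 ?pnatr_eq0.
rewrite chart_tak3 chart_ok4; have [->|b0] := eqVneq b 0.
  by rewrite phi_tak3 evM evXn evY expr0n !mul0r eqxx.
move=> /=; rewrite mulf_eq0 negb_or => /andP[w0 _].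
rewrite /den3 /num3 /sq3 !evE !mulf_eq0 !negb_or => /andP[_ h0].
rewrite invr_eq0 !mulf_eq0 (negbTE b0) (negbTE w0) (negbTE h0) !pnatr_eq0 /=.
have := ev_T3 a b.
have : a = (ev W3 a b - 4 * a1) / b ^+ 2 by rewrite ev_qlow; field.
move: (ev W3 a b) (ev T3 a b) w0 h0 => w h w0 h0 -> hE.
(* Eliminating a1 keeps h, which occurs in denominators, as a free variable for [field]. *)
have -> : a1 = (h - (t * b ^+ 2 * w ^+ 2 + w + 1 / 8 * b ^+ 4 * w ^+ 4)) / 4.
  by rewrite hE; field.
by rewrite /phi_f /phi_g; congr (Base (Some _) (Some _)); field; rewrite ?b0 ?h0 ?w0.
Qed.

Lemma local_expr_tak5 u :
  local_expr good phi (chart_u tak5) (u, 0) (AffChart K false false)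
    (polyY ^+ 2 * sq5) num5 den5.
Proof.
split=> [|a b]; first by rewrite ev_den5_0 mulf_neq0 ?expf_neq0 ?pnatr_eq0.
rewrite chart_tak5; have [->|b0] := eqVneq b 0.
  by rewrite phi_tak5 evM evXn evY expr0n !mul0r.
move=> /=; rewrite mulf_eq0 negb_or => /andP[w0 _] _.
rewrite /den5 /num5 /sq5 !evE.
have : a = (ev W5 a b + 4 * a1) / b ^+ 2 by rewrite ev_qlow; field.
move: (ev W5 a b) w0 => w w0 ->.
by rewrite /phi_f /phi_g; congr (Base (Some _) (Some _)); field; rewrite ?b0 ?w0.
Qed.

Lemma local_expr_tak14 u :
  local_expr good phi (chart_u tak14) (u, 0) (chart_u ok8) num14 (polyY ^+ 2 * sq14) den14.
Proof.
split=> [|a b]; first by rewrite ev_den14_0 pnatr_eq0.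
rewrite chart_tak14 chart_ok8; have [->|b0] := eqVneq b 0.
  by rewrite phi_tak14 evM evXn evY expr0n !mul0r eqxx.
rewrite /inP1; case: eqP => //= /eqP; rewrite mulf_eq0 negb_or => /andP[_ s0] _ h0.
have T0 : ev T14 a b != 0 by move: h0; rewrite /den14 evM mulf_eq0 negb_or => /andP[].
have -> : ev (polyY ^+ 2 * sq14) a b / ev den14 a b = 4 * b ^+ 2.
  by rewrite /den14 /sq14 !evE; field.
have V0 : 4 * b ^+ 2 != 0 by rewrite mulf_neq0 ?expf_neq0 ?pnatr_eq0.
rewrite (negbTE V0).
(* Here 4 * b ^ 2 is 1 / f and [Gok8] is f / g. *)
have -> : ev (Gok8 t a1 a2) (ev num14 a b / ev den14 a b) (4 * b ^+ 2) =
          ev Phigh14 a b / ev T14 a b.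
  apply/(canRL (mulfK T0)); rewrite ev_G8 /den14 evM evC.
  transitivity ((2 - 4 * t * (4 * b ^+ 2) + c8 * (4 * b ^+ 2) ^+ 2) * ev T14 a b
                + ev num14 a b * b ^+ 6).
    by rewrite /c8; field.
  by rewrite /num14 !evE ev_T14 ev_Phigh /l2 /l3 /l4 /c8 /c14; field.
rewrite mulf_eq0 (negbTE V0) mulf_eq0 invr_eq0 (negbTE s0) (negbTE T0) /=.
have -> : phi_g t a1 b^-1 (b ^+ 3 * ev Phigh14 a b)^-1 =
          ev T14 a b / (4 * b ^+ 2 * ev Phigh14 a b).
  by rewrite /phi_g ev_T14; field; rewrite ?b0 ?s0.
by rewrite /phi_f; congr (Base (Some _) (Some _)); field; rewrite ?b0 ?s0 ?T0.
Qed.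

Lemma local_expr_tak20 u :
  local_expr good phi (chart_u tak20) (u, 0) (chart_u ok2) num20 (polyY ^+ 2 * sq20) den20.
Proof.
split=> [|a b]; first by rewrite ev_den20_0 oppr_eq0 pnatr_eq0.
rewrite chart_tak20 chart_ok2; have [->|b0] := eqVneq b 0.
  by rewrite phi_tak20 evM evXn evY expr0n !mul0r eqxx.
rewrite /inP1; case: eqP => //= /eqP; rewrite mulf_eq0 negb_or => /andP[_ s0] _ h0.
have -> : ev (polyY ^+ 2 * sq20) a b / ev den20 a b = 4 * b ^+ 2.
  by rewrite /den20 /sq20 !evE; field.
have V0 : 4 * b ^+ 2 != 0 by rewrite mulf_neq0 ?expf_neq0 ?pnatr_eq0.
rewrite (negbTE V0) /phi_f /phi_g; congr (Base (Some _) (Some _)); first by field.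
rewrite /den20 evM evC.
have E : ev num20 a b * b ^+ 6 =
    2 + ev Phigh20 a b * (1 / 4 + 2 * t * b ^+ 2 + k20 * b ^+ 4).
  by rewrite /num20 !evE ev_Phigh /k20 /c20; field.
have -> : ev num20 a b =
    (2 + ev Phigh20 a b * (1 / 4 + 2 * t * b ^+ 2 + k20 * b ^+ 4)) / b ^+ 6.
  by rewrite -E; field.
by rewrite /k20; field; rewrite ?b0 ?s0.
Qed.

End Phi.

(** * Morphism, finite fibres and branch locus *)

Section Ramification.
Variables (K : numFieldType) (t a1 a2 : K).
Hypothesis a1_neq0 : a1 != 0.
Local Notation tak3 := (tak3 a1).
Local Notation tak5 := (tak5 a1).
Local Notation tak14 := (tak14 t a1 a2).
Local Notation tak20 := (tak20 t a1 a2).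
Local Notation ok2 := (ok2 a2).
Local Notation ok4 := (ok4 a1).
Local Notation ok8 := (ok8 t a1 a2).
Local Notation sT := (tak_centers t a1 a2).
Local Notation sO := (ok_centers t a1 a2).
Local Notation good := (tak_good t a1 a2).
Local Notation phi := (phi t a1 a2).

Lemma phi_good : set_fun good (ok_good t a1 a2) phi.
Proof.
case=> [[q|] [p|]|c [u|]] // [<-|[<-|[<-|[<-|//]]]].
- by rewrite phi_tak3 /=; right; left.
- by rewrite phi_tak5.
- by rewrite phi_tak14 /=; do 2 right; left.
- by rewrite phi_tak20 //; left.
Qed.

Lemma phi_morphism : is_morphism sT good sO (ok_good t a1 a2) phi.
Proof.
split; first exact: phi_good.
case=> [[q|] [p|]|c [u|]] //= cl.
  exists (AffChart K false false), (q, p), (AffChart K false false).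
  by do 3 eexists; split=> //; exact: local_expr_base.
exists (chart_u c), (u, 0); rewrite chart_pt_u0.
have cs : is_chart sT (chart_u c).
  by case: c cl => c x y /tak_leaves_centers.
have [cE|[cE|[cE|[cE|//]]]] := cl; subst c.
- exists (chart_u ok4); do 3 eexists; split=> //; last exact: local_expr_tak3.
  by rewrite /=; tauto.
- exists (AffChart K false false); do 3 eexists; split=> //.
  exact: local_expr_tak5.
- exists (chart_u ok8); do 3 eexists; split=> //; last exact: local_expr_tak14.
  by rewrite /=; tauto.
- exists (chart_u ok2); do 3 eexists; split=> //; last exact: local_expr_tak20.
  by rewrite /=; tauto.
Qed.

Lemma finite_subsingleton (T : Type) (A : set T) :
  (forall x y, A x -> A y -> x = y) -> finite_set A.
Proof.
move=> A1; have [->|/set0P[x Ax]] := eqVneq A set0; first exact: finite_set0.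
by apply: sub_finite_set (finite_set1 x) => y Ay; exact: A1.
Qed.

Lemma phi_fibre_base y (q : K) :
  finite_set [set x | (exists p, x = Base (Some q) (Some p)) /\ q != 0 /\ phi x = y].
Proof.
apply: finite_subsingleton => _ _ [[p ->] [q0 <-]] [[p' ->] [_ /= []]].
rewrite /phi_g => /addIr /addrI.
have q20 : 2 * q != 0 by rewrite mulf_neq0 ?pnatr_eq0.
by move/(mulIf (invr_neq0 q20)) ->.
Qed.

Lemma affine_inj (al be : K) : al != 0 -> injective (fun u => u / al + be).
Proof. by move=> al0 u v /addIr /(mulIf (invr_neq0 al0)). Qed.

Lemma phi_fibre_exc y c : List.In c [:: tak3; tak5; tak14; tak20] ->
  finite_set [set x | (exists u, x = Exc c (Some u)) /\ phi x = y].
Proof.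
have a3 : 32 * a1 != 0 by rewrite mulf_neq0 ?pnatr_eq0.
have a5 : 32 * a1 ^+ 2 != 0 by rewrite mulf_neq0 ?expf_neq0 ?pnatr_eq0.
move=> cl; apply: finite_subsingleton => _ _ [[u ->] <-] [[v ->]].
have [cE|[cE|[cE|[cE|//]]]] := cl; subst c.
- by rewrite !phi_tak3 => -[]; rewrite !phi_affine3 // => /(affine_inj a3) ->.
- by rewrite !phi_tak5 // => -[]; rewrite !phi_affine5 // => /(affine_inj a5) ->.
- rewrite !phi_tak14 => -[]; rewrite !phi_affine14.
  by move=> /affine_inj ->; rewrite ?pnatr_eq0.
- rewrite !phi_tak20 // => -[]; rewrite !phi_affine20.
  move=> /affine_inj; rewrite pnatr_eq0 => /(_ isT) /oppr_inj ->; by [].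
Qed.

Lemma phi_fibre y : finite_set (good `&` phi @^-1` [set y]).
Proof.
pose B (q : K) := [set x | (exists p, x = Base (Some q) (Some p)) /\ q != 0 /\ phi x = y].
pose E c := [set x | (exists u, x = Exc c (Some u)) /\ phi x = y].
(* Equal values of f give q = q0 or q = - q0; without affine points in the fibre any q0 will do. *)
have [q0 Hq] : exists q0, forall q p, q != 0 -> phi (Base (Some q) (Some p)) = y ->
    q = q0 \/ q = - q0.
  have [[q0 [p0 [q00 yE]]]|no] :=
    pselect (exists q p, q != 0 /\ phi (Base (Some q) (Some p)) = y).
    exists q0 => q p _; rewrite -yE => -[/eqP + _].
    rewrite /phi_f eqf_sqr -mulNr => /orP[] /eqP /(mulIf _) -> //;
      by [left | right | rewrite invr_eq0 pnatr_eq0].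
  by exists 0 => q p q0 yE; case: no; exists q, p.
apply: (@sub_finite_set _ _ (B q0 `|` B (- q0) `|` E tak3 `|` E tak5 `|` E tak14 `|` E tak20)).
  case=> [[q|] [p|]|c [u|]] [] //= cl yE.
    by do 4 left; have [qE|qE] := Hq q p cl yE; [left | right]; split=> //;
      (try by exists p; rewrite qE); rewrite -qE.
  by case: cl => [<-|[<-|[<-|[<-|//]]]] in yE *;
    [do 3 left; right | do 2 left; right | left; right | right]; split=> //; exists u.
rewrite !finite_setU; repeat split; (try exact: phi_fibre_base);
  apply: phi_fibre_exc => /=; tauto.
Qed.

(** [ramified_at] allows any local expression, so the identities N1 / h = f and N2 / h = g are first
    made polynomial, then differentiated. *)
Lemma base_unramified q p : q != 0 -> ~ ramified_at good phi (Base (Some q) (Some p)).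
Proof.
move=> q0 [N1 [N2 [h [[/= h0 E]]]]].
have hX0 : h * 'X != 0.
  rewrite mulf_neq0 ?polyX_eq0 //; apply: contraNneq h0 => ->.
  by rewrite /ev !horner0.
have val a b : ev (h * 'X) a b != 0 ->
    ev N1 a b / ev h a b = phi_f a /\ ev N2 a b / ev h a b = phi_g t a1 a b.
  rewrite evM evX mulf_eq0 negb_or => /andP[hab a0].
  by have [] := E a b a0 hab.
have E1 : N1 * polyK 4 = 'X ^+ 2 * h.
  apply: (ev_inj hX0) => a b hab; have [+ _] := val a b hab.
  move: hab; rewrite evM evX mulf_eq0 negb_or => /andP[hab a0].
  move/(canRL (divfK hab)) => N1E; rewrite !evE N1E /phi_f.
  by field.
have E2 : N2 * (polyK 16 * 'X ^+ 2) =
    (polyK (8 * t) * 'X ^+ 2 + polyK (32 * a1) + polyK 8 * 'X * polyY K + 'X ^+ 4) * h.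
  apply: (ev_inj hX0) => a b hab; have [_ +] := val a b hab.
  move: hab; rewrite evM evX mulf_eq0 negb_or => /andP[hab a0].
  move/(canRL (divfK hab)) => N2E; rewrite !evE N2E /phi_g.
  by field.
have evdX := congr1 (fun P => ev (dX P) q p) E1.
have evdY := congr1 (fun P => ev (dY P) q p) E1.
have evdY2 := congr1 (fun P => ev (dY P) q p) E2.
have ev1E := congr1 (fun P => ev P q p) E1.
have ev2E := congr1 (fun P => ev P q p) E2.
rewrite /jacobian /dquot /=.
move: evdX evdY evdY2 ev1E ev2E => /=.
rewrite !exprS expr0 !mulr1 !(dYD, dXM, dYM, dXC, dXX, dXY, dYC, dYX, dYY).
rewrite !(ev0, evD, evM, evC, evX, evY, ev1).
rewrite !(mul0r, mulr0, addr0, add0r, mul1r, mulr1).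
have n4 : 4 != 0 :> K by rewrite pnatr_eq0.
have n16 : 16 * (q * q) != 0 by rewrite !mulf_neq0 ?pnatr_eq0.
move=> /(canRL (mulfK n4)) -> /(canRL (mulfK n4)) -> /(canRL (mulfK n16)) ->.
move=> /(canRL (mulfK n4)) -> /(canRL (mulfK n16)) ->.
(* f does not depend on p, so the Jacobian is the product of df/dq = q / 2 and dg/dp = 1 / (2 *
   q). *)
move=> J; have /eqP : 1 / 4 = 0 :> K by rewrite -J; field; rewrite ?q0 ?h0.
by rewrite mul1r invr_eq0 (negbTE n4).
Qed.

(** The open set f != 0 of the affine chart misses A, hence its proper transform. *)
Lemma ok_proper_transform_base (A : set (spoint K)) f g :
  (forall f' g', A (Base (Some f') (Some g')) -> f' = 0) ->
  proper_transform sO A (Base (Some f) (Some g)) -> f = 0.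
Proof.
move=> A0 fA; apply: contrapT => /eqP f0; move: fA.
apply: (@proper_transform_out _ sO (AffChart K false false) 'X f g) => //.
  by rewrite evX.
by move=> a b; rewrite evX => /eqP a0 /A0.
Qed.

Lemma phi_branch_locus : branch_locus good phi =
  (proper_transform sO (exc_curve ok2) `|` proper_transform sO (exc_curve ok4) `|`
   proper_transform sO (exc_curve ok8) `|` proper_transform sO (line_x (Some 0)))
  `\` ok_D t a1 a2.
Proof.
apply/seteqP; split=> [_ [x [xg ram] <-]|y [yp nyD]].
  have yg := phi_good xg; have : (ok_X t a1 a2 `\` ok_D t a1 a2) (phi x) by rewrite ok_goodE.
  move=> [yX nyD]; split=> //.
  case: x xg ram yX {yg nyD} => [[q|] [p|]|c [u|]] // xg.
    by move/(base_unramified xg).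
  case: xg => [<-|[<-|[<-|[<-|//]]]] _.
  - rewrite phi_tak3 => yX; left; left; right; apply: sub_proper_transform.
    by split=> //; eexists.
  - rewrite phi_tak5 // => yX; right; apply: sub_proper_transform.
    by split=> //; eexists.
  - rewrite phi_tak14 => yX; left; right; apply: sub_proper_transform.
    by split=> //; eexists.
  - rewrite phi_tak20 // => yX; do 3 left; apply: sub_proper_transform.
    by split=> //; eexists.
have yX : ok_X t a1 a2 y by case: yp => [[[]|]|] [].
have : ok_good t a1 a2 y by rewrite -ok_goodE.
case: y yp {nyD yX} => [[f|] [g|]|c [v|]] // yp.
  have -> : f = 0.
    by case: yp => [[[]|]|]; apply: ok_proper_transform_base => f' g' [? []].
  (* This preimage, like the three below, inverts the corresponding lemma [phi_affine*]. *)
  move=> _; exists (Exc tak5 (Some ((g - t / 2) * (32 * a1 ^+ 2)))).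
    split; first by right; left.
    exists (polyY K ^+ 2 * sq5 a1), (num5 t a1), (den5 a1); split.
      by rewrite phi_tak5 //; exact: local_expr_tak5.
    exact: jacobian_vsq1.
  rewrite phi_tak5 // phi_affine5 // mulfK ?subrK //.
  by rewrite mulf_neq0 ?expf_neq0 ?pnatr_eq0.
move=> [<-|[<-|[<-|//]]].
- exists (Exc tak20 (Some (- ((v + (2 * t * c20 t a1 a2 + 64 * t * k20 a1 a2) / 512) * 2048)))).
    split; first by do 3 right; left.
    exists (num20 t a1 a2), (polyY K ^+ 2 * sq20 t a1 a2), (den20 t a1 a2); split.
      by rewrite phi_tak20 //; exact: local_expr_tak20.
    exact: jacobian_vsq2.
  by rewrite phi_tak20 // phi_affine20 opprK mulfK ?addrK // pnatr_eq0.
- exists (Exc tak3 (Some ((v - a1 * t / 2) * (32 * a1)))).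
    split; first by left.
    exists (num3 t a1), (polyY K ^+ 2 * sq3 a1), (den3 t a1); split.
      by rewrite phi_tak3 //; exact: local_expr_tak3.
    exact: jacobian_vsq2.
  rewrite phi_tak3 phi_affine3 // mulfK ?subrK //.
  by rewrite mulf_neq0 ?pnatr_eq0.
- exists (Exc tak14 (Some ((v - (64 * t * l2 t a1 a2 - 8 * l3 t a1 a2) / 256) * 512))).
    split; first by do 2 right; left.
    exists (num14 t a1 a2), (polyY K ^+ 2 * sq14 t a1 a2), (den14 t a1 a2); split.
      by rewrite phi_tak14 //; exact: local_expr_tak14.
    exact: jacobian_vsq2.
  by rewrite phi_tak14 phi_affine14 mulfK ?subrK // pnatr_eq0.
Qed.

End Ramification.

Theorem proposition5 (R : realType) (t a1 a2 : R[i]) (ha1 : a1 != 0) :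
  let XT := tak_X t a1 a2 `\` tak_D t a1 a2 in
  let XO := ok_X t a1 a2 `\` ok_D t a1 a2 in
  let sT := tak_centers t a1 a2 in
  let sO := ok_centers t a1 a2 in
  exists phi : spoint R[i] -> spoint R[i],
    [/\ forall q p : R[i], q != 0 ->
          phi (Base (Some q) (Some p)) =
          Base (Some (phi_f q)) (Some (phi_g t a1 q p)),
        is_morphism sT XT sO XO phi,
        critical_locus sT XT phi = set0,
        forall y, XO y -> finite_set (XT `&` phi @^-1` [set y]) &
        branch_locus XT phi =
          (proper_transform sO (exc_curve (ok2 a2)) `|`
           proper_transform sO (exc_curve (ok4 a1)) `|`
           proper_transform sO (exc_curve (ok8 t a1 a2)) `|`
           proper_transform sO (line_x (Some 0))) `\` ok_D t a1 a2].
Proof.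
move=> XT XO sT sO; rewrite /XT /XO tak_goodE // ok_goodE.
have fin := phi_fibre t a2 ha1.
exists (phi t a1 a2); split=> //.
- exact: phi_morphism.
- apply: critical_locus_finite_fibres => //.
    by move=> x; apply: tak_good_blowup.
  case=> [x y|c [u|]] //= /tak_leaves_centers; by case: c.
- exact: phi_branch_locus.
Qed.
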